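(* Let $A,B\in 2^\omega$. If $A\not\le_T B$, then for every wtt-reduction $\Phi$ there exists $X\in 2^\omega$ such that $\dim_{si\Delta^0_1(A)}(X)=1$ and, either $\Phi^X$ is not total or $\dim_{si\Delta^0_1(B)}(\Phi^X)=0$.
   Context: Reals are elements of $2^\omega$, identified with subsets of $\omega$. $\le_T$ is Turing reducibility. For $X\in 2^\omega$, $X\upharpoonright n$ is the prefix of $X$ of length $n$, and $K$ denotes prefix-free Kolmogorov complexity. For an oracle $Y\in 2^\omega$, $$\dim_{si\Delta^0_1(Y)}(X)=\sup_{N}\ \inf_{n\in N}\frac{K(X\upharpoonright n)}{n},$$ where $N$ ranges over all infinite $\Delta^0_1(Y)$ (that is, $Y$-computable) subsets of $\omega$. Quotients are considered only for $n\ge 1$. A wtt-reduction (weak truth-table reduction) is an oracle machine $\Phi$ (with $\{0,1\}$-valued outputs) for which there is a computable function $f$ such that for every oracle $X$ and every $n$ the use of $\Phi^X(n)$ is bounded by $f(n)$; $\Phi^X(n)$ is not guaranteed to halt. When $\Phi^X$ is total it is regarded as an element of $2^\omega$. *)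

(* Defs.v *)
From mathcomp Require Import all_boot all_order all_algebra.
From mathcomp Require Import all_classical all_reals ereal.
From Stdlib Require Cantor.
Set Implicit Arguments.
Unset Strict Implicit.
Unset Printing Implicit Defensive.
Import Order.TTheory GRing.Theory Num.Theory.
Local Open Scope nat_scope.
Local Open Scope classical_set_scope.

Notation oracle := (nat -> bool).

Definition npair (a b : nat) : nat := Cantor.to_nat (a, b).

(* Oracle machines, as Kleene's partial recursive functionals in unary form:
   several arguments are packed into one with Cantor's bijection. *)
Inductive program : Type :=
| CZero | CSucc | CFst | CSnd | COracle
| CPair of program & program
| CComp of program & program
| CPrec of program & program
| CMu of program.

(* [run Y c x v u]: with oracle Y, machine c halts on input x with output v
   and use u, the use being 0 if no query is made and otherwise one plus the
   largest queried position.
   [CPrec f g] maps <a, 0> to f(a) and <a, n+1> to g <a, <n, r>>, r being its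
   value at <a, n>.  [CMu c] maps <a, m> to the least n >= m such that
   c <a, n> = 0, provided c halts on <a, i> for every m <= i < n. *)
Inductive run (Y : oracle) : program -> nat -> nat -> nat -> Prop :=
| EZero x : run Y CZero x 0 0
| ESucc x : run Y CSucc x x.+1 0
| EFst a b : run Y CFst (npair a b) a 0
| ESnd a b : run Y CSnd (npair a b) b 0
| EOracle x : run Y COracle x (nat_of_bool (Y x)) x.+1
| EPair f g x a b u w :
    run Y f x a u -> run Y g x b w ->
    run Y (CPair f g) x (npair a b) (maxn u w)
| EComp f g x y z u w :
    run Y g x y u -> run Y f y z w ->
    run Y (CComp f g) x z (maxn u w)
| EPrec0 f g a v u :
    run Y f a v u -> run Y (CPrec f g) (npair a 0) v u
| EPrecS f g a n r v u w :
    run Y (CPrec f g) (npair a n) r u ->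
    run Y g (npair a (npair n r)) v w ->
    run Y (CPrec f g) (npair a n.+1) v (maxn u w)
| EMuStop c a n u :
    run Y c (npair a n) 0 u -> run Y (CMu c) (npair a n) n u
| EMuNext c a n r v u w :
    run Y c (npair a n) r.+1 u ->
    run Y (CMu c) (npair a n.+1) v w ->
    run Y (CMu c) (npair a n) v (maxn u w).

Definition computes (Y : oracle) (c : program) (x v : nat) : Prop :=
  exists u, run Y c x v u.

Definition no_oracle : oracle := fun=> false.

Definition computable (f : nat -> nat) : Prop :=
  exists c, forall n, computes no_oracle c n (f n).

(* As an element of Cantor space, the total output of c with oracle Y is Z. *)
Definition computes_set (c : program) (Y Z : oracle) : Prop :=
  forall n, computes Y c n (nat_of_bool (Z n)).

Definition turing_le (A B : oracle) : Prop := exists c, computes_set c B A.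

Definition total_with (c : program) (Y : oracle) : Prop :=
  forall n, exists v, computes Y c n v.

(* Only halting computations have a use. *)
Definition wtt_reduction (c : program) : Prop :=
  (forall X n v, computes X c n v -> v <= 1) /\
  exists2 f : nat -> nat, computable f &
    forall X n v u, run X c n v u -> u <= f n.

(* Bijective base-2 numeration, a computable bijection from strings to nat. *)
Fixpoint str_code (s : bitseq) : nat :=
  if s is b :: s' then ((str_code s').*2 + b).+1 else 0.

Definition machine (c : program) (p s : bitseq) : Prop :=
  computes no_oracle c (str_code p) (str_code s).

Definition prefix_free (c : program) : Prop :=
  forall p q s t, machine c p s -> machine c q t -> prefix p q -> p = q.

Definition optimal (U : program) : Prop :=
  prefix_free U /\
  forall c, prefix_free c -> exists d, forall p s, machine c p s ->
    exists2 q, machine U q s & size q <= size p + d.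

(* K is prefix-free Kolmogorov complexity with respect to some optimal
   prefix-free machine; such a K is unique up to a bounded additive term. *)
Definition prefix_free_complexity (K : bitseq -> nat) : Prop :=
  exists2 U, optimal U & forall s,
    (exists2 p, machine U p s & size p = K s) /\
    (forall p, machine U p s -> K s <= size p).

Section Dimension.
Variables (R : realType) (K : bitseq -> nat).
Local Open Scope ring_scope.

Definition complexity_rate (X : oracle) (n : nat) : \bar R :=
  ((K (mkseq X n))%:R / n%:R)%:E.

Definition dim_si (Y X : oracle) : \bar R :=
  ereal_sup
    [set ereal_inf [set complexity_rate X n | n in [set n | N n && (0 < n)%N]]
       | N in [set N : oracle | turing_le N Y /\ infinite_set [set n | N n]]].

End Dimension.

(* Main.v *)
Require Import Defs.
From mathcomp Require Import all_boot all_order all_algebra.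
From mathcomp Require Import all_classical all_reals ereal.
From mathcomp Require Import zify.
Set Implicit Arguments.
Unset Strict Implicit.
Unset Printing Implicit Defensive.

(* Let [f] be the computable use bound of Phi.  Fix a computable sequence of
   levels growing fast relative to [f], and code each prefix of A by a level of
   even index, so that A computes the set of coding levels.  Between two
   consecutive coding levels a < a', X is zero except on a final part, starting
   at o(a'), where it is incompressible; so K (X|a') >= a' - o(a'), and X has
   dimension 1 along the coding levels.  If Phi is total on every oracle, a
   length m that is not next to a coding level satisfies K (Phi^X|m) = o(m):
   below its use, X is a prefix of length at most sqrt m followed by zeros.  A
   B-computable infinite set on which the complexity rate of Phi^X stays away
   from 0 therefore has almost all elements next to coding levels, from which B
   would recover A.  If Phi diverges on some oracle, the divergence depends only
   on a finite prefix of the oracle, and X is started with that prefix. *)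

(** * Projections of Cantor's pairing *)

Definition cfst (x : nat) : nat := (Cantor.of_nat x).1.
Definition csnd (x : nat) : nat := (Cantor.of_nat x).2.

Lemma npair_fst a b : cfst (npair a b) = a.
Proof. by rewrite /cfst /npair Cantor.cancel_of_to. Qed.

Lemma npair_snd a b : csnd (npair a b) = b.
Proof. by rewrite /csnd /npair Cantor.cancel_of_to. Qed.

Lemma npairK x : npair (cfst x) (csnd x) = x.
Proof. by rewrite /npair -surjective_pairing Cantor.cancel_to_of. Qed.

Lemma npair_inj a b a' b' : npair a b = npair a' b' -> a = a' /\ b = b'.
Proof.
by move=> h; rewrite -(npair_fst a b) -{2}(npair_snd a b) h npair_fst npair_snd.
Qed.

(** A pair is [csnd x] plus the triangular number of the coordinate sum. This quadratic growth makes
    self-delimiting codes of lengths cheap. *)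
Lemma cfst_csnd_sqr x : (cfst x + csnd x) * (cfst x + csnd x) <= x.*2.
Proof.
have := Cantor.to_nat_spec (cfst x) (csnd x).
rewrite -/(npair _ _) npairK; nia.
Qed.

(** * Oracle machines *)

Lemma run_det Y c x v u v' u' : run Y c x v u -> run Y c x v' u' -> v = v'.
Proof.
move=> h; elim: h v' u' => {c x v u}; intros;
  match goal with H : run _ _ ?x ?v' _ |- _ = ?v' =>
    (* keeps [inversion] from unfolding [npair] *)
    remember x; inversion H; subst; clear H
  end;
  repeat match goal with
  | H : npair _ _ = npair _ _ |- _ =>
      let e1 := fresh in let e2 := fresh in
      have [e1 e2] := npair_inj H; clear H; try discriminate e2;
      try (injection e2; clear e2; intro e2); subst
  | IH : forall v' u', run ?Y ?c ?x v' u' -> _ = v', H : run ?Y ?c ?x _ _ |- _ =>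
      let e := fresh in
      have e := IH _ _ H; clear H; try discriminate e;
      try (injection e; clear e; intro e); subst
  end; try done.
Qed.

Lemma computes_det Y c x v v' : computes Y c x v -> computes Y c x v' -> v = v'.
Proof. by move=> [u h] [u' h']; apply: run_det h h'. Qed.

Lemma run_use Y Y' c x v u :
  (forall i, i < u -> Y i = Y' i) -> run Y c x v u -> run Y' c x v u.
Proof.
move=> eqY h; elim: h eqY => {c x v u}; try by move=> *; constructor.
- move=> x eqY; rewrite eqY //; exact: EOracle.
- move=> f g x a b u w _ IHf _ IHg eqY; apply: EPair.
    by apply: IHf => i ltiu; apply: eqY; rewrite leq_max ltiu.
  by apply: IHg => i ltiw; apply: eqY; rewrite leq_max ltiw orbT.
- move=> f g x y z u w _ IHg _ IHf eqY; apply: EComp.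
    by apply: IHg => i ltiu; apply: eqY; rewrite leq_max ltiu.
  by apply: IHf => i ltiw; apply: eqY; rewrite leq_max ltiw orbT.
- by move=> f g a v u _ IH eqY; apply: EPrec0; apply: IH.
- move=> f g a n r v u w _ IH1 _ IH2 eqY; apply: EPrecS.
    by apply: IH1 => i ltiu; apply: eqY; rewrite leq_max ltiu.
  by apply: IH2 => i ltiw; apply: eqY; rewrite leq_max ltiw orbT.
- by move=> c a n u _ IH eqY; apply: EMuStop; apply: IH.
- move=> c a n r v u w _ IH1 _ IH2 eqY; apply: EMuNext.
    by apply: IH1 => i ltiu; apply: eqY; rewrite leq_max ltiu.
  by apply: IH2 => i ltiw; apply: eqY; rewrite leq_max ltiw orbT.
Qed.

Lemma run_mu_zero Y c a n v u :
  run Y (CMu c) (npair a n) v u -> exists m, computes Y c (npair a m) 0.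
Proof.
move ec: (CMu c) => c'; move ex: (npair a n) => x h.
elim: h n ec ex => // {c' x v u}.
- by move=> d b m w hr _ n [->] /npair_inj [-> _]; exists m, w.
- move=> d b m r w u' w' _ _ _ IH n [ec] /npair_inj [eb en].
  by apply: (IH m.+1); rewrite ?ec ?eb.
Qed.

Section ComputesRules.
Variable Y : oracle.

Lemma computes_fst x : computes Y CFst x (cfst x).
Proof. by exists 0; rewrite -{1}(npairK x); apply: EFst. Qed.

Lemma computes_snd x : computes Y CSnd x (csnd x).
Proof. by exists 0; rewrite -{1}(npairK x); apply: ESnd. Qed.

Lemma computes_pair c d x a b :
  computes Y c x a -> computes Y d x b -> computes Y (CPair c d) x (npair a b).
Proof. by move=> [u hu] [w hw]; exists (maxn u w); apply: EPair. Qed.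

Lemma computes_comp c d x y z :
  computes Y d x y -> computes Y c y z -> computes Y (CComp c d) x z.
Proof. by move=> [u hu] [w hw]; exists (maxn u w); apply: EComp hu hw. Qed.

Lemma computes_comp_inv c d x z :
  computes Y (CComp c d) x z -> exists2 y, computes Y d x y & computes Y c y z.
Proof. by case=> u h; inversion h; subst; exists y; eexists; eassumption. Qed.

Lemma computes_prec0 f g a v :
  computes Y f a v -> computes Y (CPrec f g) (npair a 0) v.
Proof. by move=> [u hu]; exists u; apply: EPrec0. Qed.

Lemma computes_precS f g a n r v :
  computes Y (CPrec f g) (npair a n) r ->
  computes Y g (npair a (npair n r)) v ->
  computes Y (CPrec f g) (npair a n.+1) v.
Proof. by move=> [u hu] [w hw]; exists (maxn u w); apply: EPrecS hu hw. Qed.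

Lemma computes_mu_stop c a n :
  computes Y c (npair a n) 0 -> computes Y (CMu c) (npair a n) n.
Proof. by move=> [u hu]; exists u; apply: EMuStop. Qed.

Lemma computes_mu_next c a n r v :
  computes Y c (npair a n) r.+1 -> computes Y (CMu c) (npair a n.+1) v ->
  computes Y (CMu c) (npair a n) v.
Proof. by move=> [u hu] [w hw]; exists (maxn u w); apply: EMuNext hu hw. Qed.

Lemma computes_mu c a (P : pred nat) n :
  (forall i, computes Y c (npair a i) (~~ P i)) ->
  P n -> (forall i, P i -> n <= i) -> computes Y (CMu c) (npair a 0) n.
Proof.
move=> hP Pn minn.
(* Induction on the distance [d] from the starting point of the search to [n]. *)
suff: forall d, d <= n -> computes Y (CMu c) (npair a (n - d)) n.
  by move=> /(_ n (leqnn _)); rewrite subnn.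
elim=> [|d IH] ledn.
  by rewrite subn0; apply: computes_mu_stop; have := hP n; rewrite Pn.
apply: (@computes_mu_next _ _ _ 0).
  have := hP (n - d.+1); case: (boolP (P _)) => //= /minn; lia.
by rewrite subnSK //; apply: IH; apply: ltnW.
Qed.

End ComputesRules.

Definition CId := CPair CFst CSnd.

Lemma computes_id Y x : computes Y CId x x.
Proof.
rewrite -{2}(npairK x).
by apply: computes_pair; [apply: computes_fst|apply: computes_snd].
Qed.

(** [CPrec] and [CMu] split their input into parameter and counter, so a carried parameter [s] must
    be regrouped between <s, <a, n>> and <<s, a>, n>. *)
Definition assoc_r := CPair (CComp CFst CFst) (CPair (CComp CSnd CFst) CSnd).
Definition assoc_l := CPair (CPair CFst (CComp CFst CSnd)) (CComp CSnd CSnd).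

Lemma computes_assoc_r Y s a n :
  computes Y assoc_r (npair (npair s a) n) (npair s (npair a n)).
Proof.
have h1 : computes Y CFst (npair (npair s a) n) (npair s a) by exists 0; apply: EFst.
apply: computes_pair; first by apply: (computes_comp h1); exists 0; apply: EFst.
by apply: computes_pair; [apply: (computes_comp h1)|]; exists 0; apply: ESnd.
Qed.

Lemma computes_assoc_l Y s a n :
  computes Y assoc_l (npair s (npair a n)) (npair (npair s a) n).
Proof.
have h1 : computes Y CSnd (npair s (npair a n)) (npair a n) by exists 0; apply: ESnd.
apply: computes_pair; last by apply: (computes_comp h1); exists 0; apply: ESnd.
by apply: computes_pair; [|apply: (computes_comp h1)]; exists 0; apply: EFst.
Qed.

(* Replaces oracle queries by calls to [o], carrying a parameter along. *)
Fixpoint simulate (o c : program) : program :=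
  match c with
  | COracle => o
  | CPair f g => CPair (simulate o f) (simulate o g)
  | CComp f g => CComp (simulate o f) (CPair CFst (simulate o g))
  | CPrec f g =>
      CComp (CPrec (simulate o f) (CComp (simulate o g) assoc_r)) assoc_l
  | CMu f => CComp (CMu (CComp (simulate o f) assoc_r)) assoc_l
  | _ => CComp c CSnd
  end.

Lemma simulateP (Y Z : oracle) o s :
  (forall i, computes Y o (npair s i) (Z i)) ->
  forall c x v, computes Z c x v -> computes Y (simulate o c) (npair s x) v.
Proof.
move=> ho c x v [u h].
have snd y : computes Y CSnd (npair s y) y by exists 0; apply: ESnd.
have fst y : computes Y CFst (npair s y) s by exists 0; apply: EFst.
have al a n := computes_assoc_l Y s a n.
have ar a n := computes_assoc_r Y s a n.
(* Induction hypotheses for [CPrec] and [CMu] concern the program wrapped with [assoc_l], while the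
   rules need the unwrapped one. *)
have inv d a n w : computes Y (CComp d assoc_l) (npair s (npair a n)) w ->
    computes Y d (npair (npair s a) n) w.
  by case/computes_comp_inv => y /(computes_det (al a n)) <-.
elim: h => {c x v u} /=.
- by move=> x; apply: (computes_comp (snd x)); exists 0; constructor.
- by move=> x; apply: (computes_comp (snd x)); exists 0; constructor.
- by move=> a b; apply: (computes_comp (snd _)); exists 0; constructor.
- by move=> a b; apply: (computes_comp (snd _)); exists 0; constructor.
- by move=> x; apply: ho.
- by move=> f g x a b _ _ _ h1 _ h2; apply: computes_pair.
- move=> f g x y z _ _ _ h1 _ h2; apply: computes_comp h2.
  exact: computes_pair.
- move=> f g a v _ _ h1; apply: (computes_comp (al _ _)).
  exact: computes_prec0.
- move=> f g a n r v _ _ _ /inv h1 _ h2; apply: (computes_comp (al _ _)).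
  by apply: (computes_precS h1); apply: computes_comp h2; exact: computes_assoc_r.
- move=> c a n _ _ h1; apply: (computes_comp (al _ _)).
  by apply: computes_mu_stop; apply: computes_comp h1.
- move=> c a n r v _ _ _ h1 _ /inv h2; apply: (computes_comp (al _ _)).
  by apply: computes_mu_next h2; apply: computes_comp h1.
Qed.

(** * Closure properties of relative computability *)

(** At [no_oracle] this unfolds to [computable], and for boolean [f], read through [nat_of_bool], to
    [turing_le]. *)
Definition recursive (Y : oracle) (f : nat -> nat) : Prop :=
  exists c, forall x, computes Y c x (f x).

Definition recursive2 Y (F : nat -> nat -> nat) : Prop :=
  recursive Y (fun z => F (cfst z) (csnd z)).

Definition recursive3 Y (F : nat -> nat -> nat -> nat) : Prop :=
  recursive Y (fun z => F (cfst z) (cfst (csnd z)) (csnd (csnd z))).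

Section RecursiveRules.
Variable Y : oracle.
Local Notation recursive := (recursive Y).
Local Notation recursive2 := (recursive2 Y).
Local Notation recursive3 := (recursive3 Y).

Lemma rec_ext f g : f =1 g -> recursive f -> recursive g.
Proof. by move=> e [c h]; exists c => x; rewrite -e. Qed.

Lemma rec_id : recursive (fun x => x).
Proof. by exists CId => x; apply: computes_id. Qed.

Lemma rec_app F g : recursive F -> recursive g -> recursive (fun x => F (g x)).
Proof. by move=> [c h] [d k]; exists (CComp c d) => x; apply: computes_comp. Qed.

Lemma rec_pair f g :
  recursive f -> recursive g -> recursive (fun x => npair (f x) (g x)).
Proof. by move=> [c h] [d k]; exists (CPair c d) => x; apply: computes_pair. Qed.

Lemma rec_cfst f : recursive f -> recursive (fun x => cfst (f x)).
Proof. by apply: rec_app; exists CFst; apply: computes_fst. Qed.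

Lemma rec_csnd f : recursive f -> recursive (fun x => csnd (f x)).
Proof. by apply: rec_app; exists CSnd; apply: computes_snd. Qed.

Lemma rec_succ f : recursive f -> recursive (fun x => (f x).+1).
Proof. by apply: (rec_app (F := succn)); exists CSucc => x; exists 0; apply: ESucc. Qed.

Lemma rec_const k : recursive (fun=> k).
Proof.
elim: k => [|k /rec_succ //]; by exists CZero => x; exists 0; apply: EZero.
Qed.

Lemma rec_oracle f : recursive f -> recursive (fun x => Y (f x)).
Proof.
apply: (rec_app (F := fun x => Y x)).
by exists COracle => x; exists x.+1; apply: EOracle.
Qed.

Lemma rec_app2 F f g :
  recursive2 F -> recursive f -> recursive g -> recursive (fun x => F (f x) (g x)).
Proof.
move=> hF hf hg; apply: rec_ext (rec_app hF (rec_pair hf hg)) => x.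
by rewrite npair_fst npair_snd.
Qed.

(** The argument [x] itself serves as the parameter of [CPrec], so the step may depend on it. *)
Lemma rec_iteri h g k :
  recursive3 h -> recursive g -> recursive k ->
  recursive (fun x => iteri (k x) (h x) (g x)).
Proof.
move=> [ch hh] [cg hg] [ck hk].
exists (CComp (CPrec cg ch) (CPair CId ck)) => x.
apply: computes_comp; first by apply: computes_pair; [apply: computes_id|exact: hk].
elim: (k x) => [|n IH]; first exact: computes_prec0.
apply: computes_precS IH _; have := hh (npair x (npair n (iteri n (h x) (g x)))).
by rewrite !(npair_fst, npair_snd).
Qed.

Lemma rec_iter h g k :
  recursive2 h -> recursive g -> recursive k ->
  recursive (fun x => iter (k x) (h x) (g x)).
Proof.
move=> hh hg hk.
have hh3 : recursive3 (fun x (_ : nat) r => h x r).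
  by apply: (rec_app2 hh); [apply: rec_cfst|do 2 apply: rec_csnd]; exact: rec_id.
apply: rec_ext (rec_iteri hh3 hg hk) => x.
by elim: (k x) => //= n ->.
Qed.

Lemma rec_add f g : recursive f -> recursive g -> recursive (fun x => f x + g x).
Proof.
move=> hf hg; have hs : recursive2 (fun _ r : nat => r.+1).
  by apply: rec_succ; apply: rec_csnd; exact: rec_id.
apply: rec_ext (rec_iter hs hg hf) => x.
by elim: (f x) => //= n ->.
Qed.

Lemma rec_mul f g : recursive f -> recursive g -> recursive (fun x => f x * g x).
Proof.
move=> hf hg; have ha : recursive2 (fun x r => g x + r).
  apply: rec_add; last by apply: rec_csnd; exact: rec_id.
  by apply: (rec_app hg); apply: rec_cfst; exact: rec_id.
apply: rec_ext (rec_iter ha (rec_const 0) hf) => x.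
by elim: (f x) => //= n ->; rewrite mulSn.
Qed.

Lemma rec_pred f : recursive f -> recursive (fun x => (f x).-1).
Proof.
move=> hf; have h3 : recursive3 (fun _ n _ : nat => n).
  by apply: rec_cfst; apply: rec_csnd; exact: rec_id.
apply: rec_ext (rec_iteri h3 (rec_const 0) hf) => x.
by case: (f x).
Qed.

Lemma rec_sub f g : recursive f -> recursive g -> recursive (fun x => f x - g x).
Proof.
move=> hf hg; have hp : recursive2 (fun _ r : nat => r.-1).
  by apply: rec_pred; apply: rec_csnd; exact: rec_id.
apply: rec_ext (rec_iter hp hf hg) => x.
by elim: (g x) => [|n /= ->]; rewrite ?subn0 ?subnS.
Qed.

Lemma rec_not (b : nat -> bool) : recursive b -> recursive (fun x => ~~ b x).
Proof.
by move=> h; apply: rec_ext (rec_sub (rec_const 1) h) => x; case: (b x).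
Qed.

Lemma rec_and (a b : nat -> bool) :
  recursive a -> recursive b -> recursive (fun x => a x && b x).
Proof.
by move=> ha hb; apply: rec_ext (rec_mul ha hb) => x; rewrite mulnb.
Qed.

Lemma rec_leq f g : recursive f -> recursive g -> recursive (fun x => f x <= g x).
Proof.
move=> hf hg; apply: rec_ext (rec_sub (rec_const 1) (rec_sub hf hg)) => x.
by rewrite /leq; case: (f x - g x).
Qed.

Lemma rec_eq f g : recursive f -> recursive g -> recursive (fun x => f x == g x).
Proof.
move=> hf hg; apply: rec_ext (rec_and (rec_leq hf hg) (rec_leq hg hf)) => x.
by rewrite eqn_leq.
Qed.

Lemma rec_odd f : recursive f -> recursive (fun x => odd (f x)).
Proof.
move=> hf; have hn : recursive2 (fun _ r : nat => 1 - r).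
  by apply: rec_sub; [exact: rec_const|apply: rec_csnd; exact: rec_id].
apply: rec_ext (rec_iter hn (rec_const 0) hf) => x.
by elim: (f x) => //= n ->; case: (odd n).
Qed.

Lemma rec_half f : recursive f -> recursive (fun x => (f x)./2).
Proof.
move=> hf; have hn : recursive3 (fun _ n r : nat => odd n + r).
  apply: rec_add; last by do 2 apply: rec_csnd; exact: rec_id.
  by apply: rec_odd; apply: rec_cfst; apply: rec_csnd; exact: rec_id.
apply: rec_ext (rec_iteri hn (rec_const 0) hf) => x.
by elim: (f x) => //= n ->; rewrite uphalf_half.
Qed.

Lemma rec_expn2 f : recursive f -> recursive (fun x => 2 ^ f x).
Proof.
move=> hf; have hn : recursive2 (fun _ r : nat => r + r).
  by apply: rec_add; apply: rec_csnd; exact: rec_id.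
apply: rec_ext (rec_iter hn (rec_const 1) hf) => x.
by elim: (f x) => //= n ->; rewrite expnS mul2n addnn.
Qed.

Lemma rec_mu (P : nat -> nat -> bool) (exP : forall x, exists n, P x n) :
  recursive2 (fun x n => ~~ P x n) -> recursive (fun x => ex_minn (exP x)).
Proof.
move=> [c hc]; exists (CComp (CMu c) (CPair CId CZero)) => x.
apply: computes_comp.
  by apply: computes_pair; [apply: computes_id|exists 0; apply: EZero].
case: ex_minnP => n; apply: computes_mu => i.
by have := hc (npair x i); rewrite npair_fst npair_snd.
Qed.

End RecursiveRules.

Ltac rec_tac := intros; cbv beta;
  lazymatch goal with
  | |- forall _, _ => intro; rec_tac
  | |- recursive2 _ _ => rewrite /recursive2; rec_tac
  | |- recursive3 _ _ => rewrite /recursive3; rec_tac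
  | |- recursive _ cfst => exact: rec_cfst (rec_id _)
  | |- recursive _ csnd => exact: rec_csnd (rec_id _)
  | |- recursive _ (fun x => x) => exact: rec_id
  | |- recursive _ (fun _ => ?k) => exact: rec_const
  | |- recursive _ (fun x => npair _ _) => apply: rec_pair; rec_tac
  | |- recursive _ (fun x => cfst _) => apply: rec_cfst; rec_tac
  | |- recursive _ (fun x => csnd _) => apply: rec_csnd; rec_tac
  | |- recursive _ (fun x => S _) => apply: rec_succ; rec_tac
  | |- recursive _ (fun x => _ + _) => apply: rec_add; rec_tac
  | |- recursive _ (fun x => _ * _) => apply: rec_mul; rec_tac
  | |- recursive _ (fun x => _ - _) => apply: rec_sub; rec_tac
  | |- recursive _ (fun x => _.-1) => apply: rec_pred; rec_tac
  | |- recursive _ (fun x => _./2) => apply: rec_half; rec_tac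
  | |- recursive _ (fun x => 2 ^ _) => apply: rec_expn2; rec_tac
  | |- recursive _ (fun x => nat_of_bool (odd _)) => apply: rec_odd; rec_tac
  | |- recursive _ (fun x => nat_of_bool (~~ _)) => apply: rec_not; rec_tac
  | |- recursive _ (fun x => nat_of_bool (_ && _)) => apply: rec_and; rec_tac
  | |- recursive _ (fun x => nat_of_bool (_ <= _)) => apply: rec_leq; rec_tac
  | |- recursive _ (fun x => nat_of_bool (_ == _)) => apply: rec_eq; rec_tac
  | |- recursive _ (fun x => iteri _ _ _) => apply: rec_iteri; rec_tac
  | |- recursive _ (fun x => iter _ _ _) => apply: rec_iter; rec_tac
  | |- _ => try assumption; try (apply: rec_app; [assumption|rec_tac])
     ; try (apply: rec_app2; [assumption|rec_tac|rec_tac])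
  end.

(** Queries made by the program must still be answered 0, hence the simulation with [CZero]. *)
Lemma recursive_relativize Y f : computable f -> recursive Y f.
Proof.
move=> [c hc]; exists (CComp (simulate CZero c) (CPair CZero CId)) => x.
apply: computes_comp.
  by apply: computes_pair; [exists 0; apply: EZero|exact: computes_id].
by apply: (@simulateP _ no_oracle) (hc x) => i; exists 0; apply: EZero.
Qed.

(** The index of the oracle is the parameter of the simulation. This serves to run Phi on
    zero-padded finite strings. *)
Lemma recursive_simulate (c : program) (o g : nat -> nat -> bool) :
  recursive2 no_oracle (fun s i => o s i) ->
  (forall s i, computes (o s) c i (g s i)) ->
  recursive2 no_oracle (fun s i => g s i).
Proof.
move=> [co ho] hg; exists (simulate co c) => z.
rewrite -{1}(npairK z); apply: simulateP (hg _ _) => i.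
by have := ho (npair (cfst z) i); rewrite npair_fst npair_snd.
Qed.

(** * Codes of strings *)

(** Each pass strips one letter; a nonzero code is even exactly when its first letter is 1. Past the
    end the value is [false], so a code read as an oracle is its string followed by zeros. *)
Definition code_bit (x i : nat) : bool :=
  let y := iter i (fun y => y.-1./2) x in (0 < y) && ~~ odd y.

Lemma code_bitE s i : code_bit (str_code s) i = nth false s i.
Proof.
rewrite /code_bit; elim: s i => [|b s IH] [|i] //.
- by rewrite nth_nil; elim: i.+1 => // n IH; rewrite iterSr.
- by rewrite /= oddD odd_double; case: b.
- by rewrite iterSr /= addnC half_bit_double IH.
Qed.

Lemma mkseq_code_bit s : mkseq (code_bit (str_code s)) (size s) = s.
Proof.
apply: (@eq_from_nth _ false); rewrite size_mkseq // => i lti.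
by rewrite nth_mkseq // code_bitE.
Qed.

Lemma str_code_inj : injective str_code.
Proof.
elim=> [|b s IH] [|b' s'] //= [e]; congr (_ :: _).
  by have := congr1 odd e; rewrite !oddD !odd_double; case: b b' {e} => [] [].
apply: IH; by have := congr1 half e; rewrite ![_ + nat_of_bool _]addnC !half_bit_double.
Qed.

(** Shorter strings have smaller codes, and [2 ^ n.+1 - 1] strings have length at most [n]. *)
Lemma str_code_bound s : (str_code s).+1 < 2 ^ (size s).+1.
Proof.
elim: s => //= b s IH; rewrite expnS; case: b; lia.
Qed.

(** The last letter is the top digit, 1 or 2; hence codes strictly increase along prefixes. *)
Lemma str_code_rcons s b : str_code (rcons s b) = str_code s + 2 ^ size s * b.+1.
Proof. elim: s => [|c s IH] /=; first by case: b. rewrite IH expnS; lia. Qed.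

Lemma str_code_mkseqS (Z : oracle) n :
  str_code (mkseq Z n.+1) = str_code (mkseq Z n) + 2 ^ n * (Z n).+1.
Proof. by rewrite mkseqS str_code_rcons size_mkseq. Qed.

Lemma rec_code_bit Y f g :
  recursive Y f -> recursive Y g -> recursive Y (fun x => code_bit (f x) (g x)).
Proof.
move=> hf hg; rewrite /code_bit.
by apply: rec_and; rec_tac.
Qed.

Lemma rec_mkseq Y (Z : nat -> nat -> bool) g :
  recursive2 Y (fun x i => Z x i) -> recursive Y g ->
  recursive Y (fun x => str_code (mkseq (Z x) (g x))).
Proof.
move=> hZ hg.
have h : recursive Y (fun x =>
    iteri (g x) (fun i r => r + 2 ^ i * (Z x i).+1) 0).
  apply: rec_iteri; [|rec_tac|done].
  apply: rec_add; first by rec_tac.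
  apply: rec_mul; first by rec_tac.
  apply: rec_succ; apply: (rec_app2 hZ); rec_tac.
apply: rec_ext h => x; elim: (g x) => // n.
by rewrite str_code_mkseqS /= => ->.
Qed.

(** * Prefix-free complexity *)

(** On input [p] the machine searches for the least [t] with [q t = p] and outputs [out t]. Its
    domain is the range of [q], and by the last hypothesis the choice of [t] does not matter. *)
Lemma prefix_free_machine (q out : nat -> bitseq) :
  computable (fun t => str_code (q t)) ->
  computable (fun t => str_code (out t)) ->
  (forall t t', prefix (q t) (q t') -> q t = q t') ->
  (forall t t', q t = q t' -> out t = out t') ->
  exists2 c, prefix_free c & forall t, machine c (q t) (out t).
Proof.
move=> hq [cout hout] q_pf q_out.
have [ceq hceq] : recursive2 no_oracle (fun x t => ~~ (str_code (q t) == x)).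
  rewrite /recursive2; apply: rec_not; apply: rec_eq; last by rec_tac.
  by apply: (rec_app hq); rec_tac.
have ceqP x t : computes no_oracle ceq (npair x t) (~~ (str_code (q t) == x)).
  by have := hceq (npair x t); rewrite npair_fst npair_snd.
have start x : computes no_oracle (CPair CId CZero) x (npair x 0).
  by apply: computes_pair; [apply: computes_id|exists 0; apply: EZero].
set search := CComp (CMu ceq) (CPair CId CZero).
exists (CComp cout search) => [p p' s s'|t]; last first.
  have ext : exists t', str_code (q t') == str_code (q t) by exists t.
  case: (ex_minnP ext) => t' /[dup] ht' /eqP/str_code_inj e mint'.
  rewrite /machine -(q_out _ _ e); apply: computes_comp (hout t').
  apply: (computes_comp (start _)).
  exact: computes_mu (ceqP _) ht' mint'.
have dom p0 s0 : machine (CComp cout search) p0 s0 -> exists t, q t = p0.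
  case/computes_comp_inv => z /computes_comp_inv[y /(computes_det (start _)) <-].
  case=> u /run_mu_zero[t /computes_det /(_ (ceqP _ _)) e] _; exists t.
  by case: eqP e => // /str_code_inj.
by move=> /dom[t <-] /dom[t' <-]; apply: q_pf.
Qed.

(* Self-delimiting codes; by Cantor pairing, [pair_block n] costs O(sqrt n) bits. *)
Definition unary_block (n : nat) (s : bitseq) : bitseq := nseq n true ++ false :: s.

Lemma prefix_unary_block n n' s s' :
  prefix (unary_block n s) (unary_block n' s') = (n == n') && prefix s s'.
Proof. by elim: n n' => [|n IH] [|n'] //=; rewrite IH eqSS. Qed.

Lemma size_unary_block n s : size (unary_block n s) = n + (size s).+1.
Proof. by rewrite size_cat size_nseq. Qed.

Lemma rec_unary_block Y f (s : nat -> bitseq) :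
  recursive Y f -> recursive Y (fun x => str_code (s x)) ->
  recursive Y (fun x => str_code (unary_block (f x) (s x))).
Proof.
move=> hf hs.
have h : recursive Y (fun x =>
    iter (f x) (fun y => (y + y).+2) (str_code (s x) + str_code (s x)).+1).
  by rec_tac.
by apply: rec_ext h => x; rewrite /unary_block; elim: (f x) => [|n /= ->] /=; lia.
Qed.

Definition pair_cost (n : nat) : nat := cfst n + csnd n.

Definition pair_block (n : nat) (s : bitseq) : bitseq :=
  unary_block (cfst n) (unary_block (csnd n) s).

Lemma size_pair_block n s : size (pair_block n s) = pair_cost n + 2 + size s.
Proof. rewrite !size_unary_block /pair_cost; lia. Qed.

Lemma prefix_pair_block n n' s s' :
  prefix (pair_block n s) (pair_block n' s') -> n = n' /\ prefix s s'.
Proof.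
rewrite !prefix_unary_block => /and3P[/eqP e1 /eqP e2 ->]; split=> //.
by rewrite -(npairK n) e1 e2 npairK.
Qed.

Section Complexity.
Variable K : bitseq -> nat.
Hypothesis hK : prefix_free_complexity K.

(** The description is [m] and [size w] in self-delimiting form, followed by [w] verbatim. *)
Lemma complexity_le (Z : nat -> nat -> bool) :
  recursive2 no_oracle (fun x i => Z x i) ->
  exists d, forall w m, K (mkseq (Z (str_code w)) m) <=
    size w + pair_cost (size w) + pair_cost m + d.
Proof.
move=> hZ; case: hK => U [_ U_opt] KU.
(* An index [t] is <m, <l, x>>. Forcing the word coded by [x] to the announced length [l] makes the
   descriptions prefix-free for arbitrary [t]. *)
pose trunc t := mkseq (code_bit (csnd (csnd t))) (cfst (csnd t)).
pose q t := pair_block (cfst t) (pair_block (cfst (csnd t)) (trunc t)).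
pose out t := mkseq (Z (str_code (trunc t))) (cfst t).
have htrunc : recursive no_oracle (fun t => str_code (trunc t)).
  apply: rec_mkseq; last by rec_tac.
  by apply: rec_code_bit; rec_tac.
have hout : recursive no_oracle (fun t => str_code (out t)).
  apply: rec_mkseq; last by rec_tac.
  apply: (rec_app2 hZ); last by rec_tac.
  by apply: (rec_app htrunc); rec_tac.
have qprefix t t' : prefix (q t) (q t') -> cfst t = cfst t' /\ trunc t = trunc t'.
  move=> /prefix_pair_block[e1 /prefix_pair_block[e2]].
  rewrite prefixE size_mkseq e2.
  rewrite -{1}(size_mkseq (code_bit (csnd (csnd t'))) (cfst (csnd t'))).
  by rewrite take_size => /eqP <-.
have [c pfc hc] : exists2 c, prefix_free c & forall t, machine c (q t) (out t).
  apply: prefix_free_machine => //.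
  - by do 4 (apply: rec_unary_block; first by rec_tac).
  - move=> t t' h; have [e1 e2] := qprefix _ _ h.
    case/prefix_pair_block: h => _ /prefix_pair_block[e3 _].
    by rewrite /q e1 e2 e3.
  - move=> t t' e; have [e1 e2] : cfst t = cfst t' /\ trunc t = trunc t'.
      by apply: qprefix; rewrite e prefix_refl.
    by rewrite /out e1 e2.
have [d hd] := U_opt c pfc.
(* Two pair blocks with two terminators each account for the 4. *)
exists (4 + d) => w m.
pose t := npair m (npair (size w) (str_code w)).
have et : trunc t = w by rewrite /trunc /t !(npair_fst, npair_snd) mkseq_code_bit.
have [p Up lep] := hd _ _ (hc t).
have := (KU _).2 _ Up; move: lep.
rewrite /q /out et !size_pair_block /t !(npair_fst, npair_snd); lia.
Qed.

(** Counting: otherwise the [2 ^ r] extensions would have distinct programs shorter than [r], of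
    which there are fewer than [2 ^ r]. *)
Lemma incompressible_extension (s : bitseq) (r : nat) :
  exists2 w, size w = r & r <= K (s ++ w).
Proof.
case: hK => U _ KU; apply: contrapT => none.
have small (w : r.-tuple bool) :
    exists p, machine U p (s ++ w) /\ (str_code p).+1 < 2 ^ r.
  have [p Up szp] := (KU (s ++ w)).1; exists p; split=> //.
  apply: (leq_trans (str_code_bound p)); rewrite leq_exp2l // szp ltnNge.
  by apply/negP => le; apply: none; exists (tval w) => //; rewrite size_tuple.
have [p hp] := choice small.
have lt w : str_code (p w) < (2 ^ r).-1.
  by have [_] := hp w; rewrite -ltn_predRL.
have inj : injective (fun w => Ordinal (lt w)).
  move=> w w' /(congr1 val) /= /str_code_inj e; apply: val_inj => /=.
  have [h _] := hp w; have [h' _] := hp w'; rewrite e in h.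
  have /str_code_inj := computes_det h h'.
  by move/(congr1 (drop (size s))); rewrite !drop_size_cat.
have := leq_card _ inj; rewrite card_tuple card_bool card_ord.
by have := expn_gt0 2 r; lia.
Qed.

End Complexity.

(** * Dimension bounds *)

Lemma infinite_set_natP (N : pred nat) :
  infinite_set [set n | N n]%classic <-> forall m, exists2 n, m <= n & N n.
Proof.
split=> [inf m|unb /finite_seqP[s es]].
  apply: contrapT => no; apply: inf; apply: sub_finite_set (finite_II m) => n /= Nn.
  by rewrite ltnNge; apply/negP => le; apply: no; exists n.
have [n + Nn] := unb (\max_(i <- s) i).+1.
have : n \in s by have : [set` s]%classic n by rewrite -es.
by rewrite ltnNge => /(@leq_bigmax_seq _ _ xpredT id) -> //.
Qed.

Section DimensionBounds.
Import Order.TTheory GRing.Theory Num.Theory.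
Variables (R : realType) (K : bitseq -> nat).
Local Open Scope ring_scope.

(** The inequality is [K / n <= b + 1 / q] with denominators cleared; one such [n] in each [N]
    bounds the infimum over [N]. *)
Lemma dim_si_le (Y X : oracle) (b : nat) :
  (forall N : pred nat, recursive Y (fun n => N n) ->
     (forall m : nat, exists2 n, (m <= n)%N & N n) ->
     forall q : nat, exists n, [/\ N n, (0 < n)%N &
       (q * K (mkseq X n) <= (q * b + 1) * n)%N]) ->
  (dim_si R K Y X <= b%:R%:E)%E.
Proof.
move=> small; apply: ge_ereal_sup => _ [N [recN /infinite_set_natP infN] <-].
apply/lee_addgt0Pr => e e0; have [k] := ltr_add_invr e0; rewrite add0r => hk.
have [n [Nn n0 hn]] := small N recN infN k.+1.
apply: ge_ereal_inf; exists (complexity_rate R K X n).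
  by exists n; rewrite //= Nn.
rewrite /complexity_rate -EFinD lee_fin.
apply: (@le_trans _ _ (b%:R + k.+1%:R^-1)); last by rewrite lerD2l ltW.
have k0 : 0 < k.+1%:R :> R by rewrite ltr0n.
rewrite ler_pdivrMr ?ltr0n // -(ler_pM2l k0) mulrA mulrDr divff ?gt_eqF //.
by rewrite -[1]/(1%:R) -!natrM -natrD -!natrM ler_nat.
Qed.

(** The inequality is [K / n >= 1 - 1 / q] with denominators cleared. [N] may depend on [q] because
    the dimension is a supremum. *)
Lemma dim_si_ge1 (Y X : oracle) :
  (forall q : nat, exists N : pred nat, [/\ recursive Y (fun n => N n),
     (forall m : nat, exists2 n, (m <= n)%N & N n) &
     forall n, N n -> (q * n <= q * K (mkseq X n) + n)%N]) ->
  (1 <= dim_si R K Y X)%E.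
Proof.
move=> large; apply/lee_addgt0Pr => e e0; have [k] := ltr_add_invr e0.
rewrite add0r => hk.
have [N [recN infN hN]] := large k.+1.
rewrite -leeBlDr //; apply: le_ereal_sup_tmp.
exists (ereal_inf
  [set complexity_rate R K X n | n in [set n | N n && (0 < n)%N]]%classic).
  by exists N => //; split=> //; apply/infinite_set_natP.
apply: le_ereal_inf_tmp => _ [n /andP[Nn n0] <-].
rewrite /complexity_rate -EFinB lee_fin.
apply: (@le_trans _ _ (1 - k.+1%:R^-1)); first by rewrite lerD2l lerN2 ltW.
have k0 : 0 < k.+1%:R :> R by rewrite ltr0n.
rewrite ler_pdivlMr ?ltr0n // -(ler_pM2l k0) mulrA mulrBr divff ?gt_eqF //.
rewrite mulr1 mulrBl mul1r lerBlDr -!natrM -natrD ler_nat.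
exact: hN.
Qed.

Lemma dim_si_ge0 (Y X : oracle) : (0 <= dim_si R K Y X)%E.
Proof.
apply: le_ereal_sup_tmp.
exists (ereal_inf
  [set complexity_rate R K X n | n in [set n | true && (0 < n)%N]]%classic).
  exists xpredT => //; split; first exact: (rec_const Y 1).
  by apply/infinite_set_natP => m; exists m.
by apply: le_ereal_inf_tmp => _ [n _ <-]; rewrite lee_fin divr_ge0 ?ler0n.
Qed.

End DimensionBounds.

Lemma pair_cost_sqr n : pair_cost n * pair_cost n <= n.*2.
Proof. exact: cfst_csnd_sqr. Qed.

(** If [x <= 2 * q * C], then [m0] is large enough by itself; otherwise
    [2 * q * C * x <= x * x <= C * m] gives [2 * q * x <= m], and [m0] covers [2 * q * d]. *)
Lemma sqrt_negligible C q d :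
  exists m0, forall x m, m0 <= m -> x * x <= C * m -> q * (x + d) <= m.
Proof.
exists (4 * q * q * C + 2 * q * d) => x m le0 lex.
have [h|h] := leqP (2 * q * C) x; last by nia.
have [e|C0] := posnP C; first by subst C; nia.
have h1 : C * (2 * q * x) <= C * m by apply: leq_trans lex; nia.
rewrite leq_pmul2l // in h1; nia.
Qed.

Lemma complexity_le_rate K (hK : prefix_free_complexity K) (Z : nat -> nat -> bool) q :
  recursive2 no_oracle (fun x i => Z x i) ->
  exists m0, forall w m, m0 <= m -> size w * size w <= m ->
    q * K (mkseq (Z (str_code w)) m) <= m.
Proof.
(* With [pair_cost (size w) <= 2 * size w], the overhead is [x = 3 * size w + pair_cost m], and
   [x * x <= 2 * (9 * m + 2 * m)]. *)
move=> /(complexity_le hK)[d hd]; have [m0 hm0] := sqrt_negligible 22 q d.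
exists m0 => w m lem lew; apply: leq_trans (hm0 (3 * size w + pair_cost m) m lem _).
  rewrite leq_mul2l; apply/orP; right; apply: leq_trans (hd w m) _.
  have := pair_cost_sqr (size w); nia.
have := pair_cost_sqr m; nia.
Qed.

(** A prefix of length [m] describes itself with overhead [2 * pair_cost m + d], where the square of
    [2 * pair_cost m] is at most [8 * m]. *)
Lemma dim_si_le1 (R : realType) K (hK : prefix_free_complexity K) Y X :
  (dim_si R K Y X <= 1)%E.
Proof.
rewrite -[1%E]/((1%:R : R)%:E); apply: dim_si_le => N _ infN q.
have rec_bit : recursive2 no_oracle (fun x i => code_bit x i).
  by apply: rec_code_bit; rec_tac.
have [d hd] := complexity_le hK rec_bit; have [m0 hm0] := sqrt_negligible 8 q d.
have [m lem Nm] := infN (maxn m0 1); rewrite geq_max in lem.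
case/andP: lem => lem m_gt0; exists m; split=> //.
have := hd (mkseq X m) m; rewrite size_mkseq.
rewrite -[in X in mkseq _ X](size_mkseq X m) mkseq_code_bit => hKm.
have : q * (2 * pair_cost m + d) <= m.
  by apply: hm0 => //; have := pair_cost_sqr m; nia.
nia.
Qed.

(** * Construction of the real *)

Lemma padded_incompressible K (hK : prefix_free_complexity K)
    (a t : nat -> nat) (Y : oracle) :
  (forall n, a n <= t n <= a n.+1) -> (forall n, n <= a n) ->
  exists X : oracle, (forall i, i < a 0 -> X i = Y i) /\
    forall n, (forall i, a n <= i < t n -> X i = false) /\
              a n.+1 - t n <= K (mkseq X (a n.+1)).
Proof.
move=> at_ale le_a.
have ext (p : nat * bitseq) : exists v, size v = a p.1.+1 - t p.1 /\
    a p.1.+1 - t p.1 <= K ((p.2 ++ nseq (t p.1 - a p.1) false) ++ v).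
  have [v szv hv] := incompressible_extension hK
    (p.2 ++ nseq (t p.1 - a p.1) false) (a p.1.+1 - t p.1).
  by exists v.
have [w hw] := choice ext.
(* Stage [k] has length [a k]; the next one appends zeros up to [t k], then an incompressible block
   up to [a k.+1]. *)
pose S k :=
  iteri k (fun n s => (s ++ nseq (t n - a n) false) ++ w (n, s)) (mkseq Y (a 0)).
have szS k : size (S k) = a k.
  elim: k => [|k IH]; first by rewrite size_mkseq.
  rewrite /= !size_cat IH size_nseq (hw (k, _)).1 /=.
  by have := at_ale k; lia.
have nthS k l i : k <= l -> i < a k -> nth false (S l) i = nth false (S k) i.
  move=> /subnK <- lti; elim: (l - k) => //= d IH.
  have lti' : i < size (S (d + k)).
    rewrite szS; elim: d {IH} => // d IH.
    by apply: leq_trans IH _; have := at_ale (d + k); rewrite addSn; lia.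
  by rewrite -catA nth_cat lti'.
(* Position [i] is settled at stage [i.+1], whose length [a i.+1] exceeds [i]. *)
pose X i := nth false (S i.+1) i.
have XS k i : i < a k -> X i = nth false (S k) i.
  move=> lti; rewrite /X; case: (leqP k i.+1) => h; first exact: nthS.
  by rewrite [RHS](nthS i.+1) ?le_a ?(ltnW h).
exists X; split=> [i lti|n]; first by rewrite (XS 0) //= nth_mkseq.
have := at_ale n; split=> [i|]; last first.
  have -> : mkseq X (a n.+1) = S n.+1; last exact: (hw (n, _)).2.
  apply: (@eq_from_nth _ false); rewrite ?szS size_mkseq // => i lti.
  by rewrite nth_mkseq // (XS n.+1).
case/andP=> le_ai lt_it; rewrite (XS n.+1) /=; last by lia.
rewrite -catA nth_cat szS ltnNge le_ai /= nth_cat size_nseq.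
have -> : i - a n < t n - a n by lia.
by rewrite nth_nseq if_same.
Qed.

(** By monotonicity, [m] is in the range exactly when the first value at or above [m] equals [m]. *)
Lemma recursive_range Y (a : nat -> nat) :
  recursive Y a -> {homo a : m n / m < n} ->
  exists N : pred nat, [/\ recursive Y (fun n => N n), forall n, N (a n) &
    forall m, N m -> exists n, m = a n].
Proof.
move=> rec_a mono_a.
have exa m : exists n, m <= a n.
  by exists m; elim: m => // m IH; apply: leq_ltn_trans IH (mono_a _ _ _).
exists (fun m => a (ex_minn (exa m)) == m); split=> [|n|m /eqP <-]; last by eexists.
  apply: rec_eq; last by rec_tac.
  apply: (rec_app rec_a); apply: rec_mu; rewrite /recursive2.
  by apply: rec_not; rec_tac.
case: ex_minnP => k le_nk /(_ n (leqnn _)); rewrite leq_eqVlt => /orP[/eqP->//|/mono_a].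
by rewrite ltnNge le_nk.
Qed.

(** * Fast-growing levels and the coding of prefixes of [A] *)

Section Levels.
Variable f : nat -> nat.
Hypothesis rec_f : computable f.

Definition use_sum (m : nat) : nat := iteri m (fun i r => r + f i) 0.

Lemma leq_use_sum i m : i < m -> f i <= use_sum m.
Proof.
elim: m => //= m IH; rewrite ltnS leq_eqVlt => /orP[/eqP->|/IH]; lia.
Qed.

(** The square keeps a level below the root of the next, [use_sum] leaves room for the use, and the
    factor [i.+1] makes a level plus its use negligible against the next level. *)
Definition level (k : nat) : nat :=
  iteri k (fun i y => i.+1 * (y * y + use_sum y + 1)) 0.

Lemma levelS k :
  level k.+1 = k.+1 * (level k * level k + use_sum (level k) + 1).
Proof. by []. Qed.

Lemma level_sqr_lt k : level k * level k < level k.+1.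
Proof. rewrite levelS; nia. Qed.

Lemma level_lt k l : k < l -> level k < level l.
Proof.
have step n : level n < level n.+1 by have := level_sqr_lt n; nia.
elim: l => // l IH; rewrite ltnS leq_eqVlt => /orP[/eqP->//|/IH] h.
exact: ltn_trans h (step l).
Qed.

Lemma level_le k l : k <= l -> level k <= level l.
Proof. by rewrite leq_eqVlt => /orP[/eqP->//|/level_lt/ltnW]. Qed.

Lemma level_le_inv k l : level k < level l -> k < l.
Proof. by apply: contraTltn => /level_le; rewrite leqNgt. Qed.

Lemma leq_level k : k <= level k.
Proof. elim: k => // k IH; apply: leq_ltn_trans IH _; exact: level_lt. Qed.

Lemma level_unbounded m : exists k, m < level k.+1.
Proof. by exists m; apply: leq_level. Qed.

Definition level_index (m : nat) : nat := ex_minn (level_unbounded m).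

Lemma level_index_gt m : m < level (level_index m).+1.
Proof. by rewrite /level_index; case: ex_minnP. Qed.

Lemma level_index_le m : level (level_index m) <= m.
Proof.
rewrite /level_index; case: ex_minnP => [[|k] _ mink]; first by [].
by rewrite leqNgt; apply/negP => /mink; rewrite ltnn.
Qed.

Lemma rec_use_sum Y g : recursive Y g -> recursive Y (fun x => use_sum (g x)).
Proof.
have hf := recursive_relativize Y rec_f.
by move=> hg; rewrite /use_sum; rec_tac.
Qed.

Lemma rec_level Y g : recursive Y g -> recursive Y (fun x => level (g x)).
Proof.
move=> hg; rewrite /level; apply: rec_iteri; [|by rec_tac|by []].
have h := @rec_use_sum Y (fun z => csnd (csnd z)); rewrite /recursive3.
apply: rec_mul; first by rec_tac.
apply: rec_add; last by rec_tac.
apply: rec_add; first by rec_tac.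
by apply: h; rec_tac.
Qed.

Lemma rec_level_index Y g :
  recursive Y g -> recursive Y (fun x => level_index (g x)).
Proof.
apply: (rec_app (F := level_index)); apply: rec_mu.
rewrite /recursive2; apply: rec_not; apply: rec_leq; first by rec_tac.
by apply: rec_level; rec_tac.
Qed.

(** Doubling makes a coding index [c] even, so [uphalf] recovers the code of the prefix from [c] and
    from [c.-1] alike. *)
Definition prefix_level (A : oracle) (n : nat) : nat :=
  (str_code (mkseq A n)).*2.

Lemma prefix_levelS A n : (prefix_level A n).+2 <= prefix_level A n.+1.
Proof. by rewrite /prefix_level str_code_mkseqS; have := expn_gt0 2 n; nia. Qed.

Lemma leq_prefix_level A n : n <= prefix_level A n.
Proof. elim: n => // n IH; have := prefix_levelS A n; lia. Qed.

Definition length_at (A : oracle) (n : nat) : nat := level (prefix_level A n).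

(* Long enough to cover the use of Phi on all arguments below the level just
   before the next coding level. *)
Definition pad_until (A : oracle) (n : nat) : nat :=
  let l := level (prefix_level A n.+1).-1 in l + use_sum l.

Lemma length_at_pad A n : length_at A n <= pad_until A n <= length_at A n.+1.
Proof.
have := prefix_levelS A n; rewrite /pad_until /length_at.
case: (prefix_level A n.+1) => // k h; rewrite succnK; apply/andP; split.
  by apply: leq_trans (leq_addr _ _); apply: level_le; lia.
by rewrite levelS; nia.
Qed.

(** The last step up to the coding level multiplies by its index, which is at least [n.+1]. *)
Lemma pad_until_small A n q : q <= n -> q * pad_until A n <= length_at A n.+1.
Proof.
have := leq_prefix_level A n.+1; rewrite /pad_until /length_at.
case: (prefix_level A n.+1) => // k h leq; rewrite succnK levelS.
set y := level k; have h1 : y + use_sum y <= y * y + use_sum y + 1 by nia.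
by apply: leq_mul h1; lia.
Qed.

Lemma leq_length_at A n : n <= length_at A n.
Proof. exact: leq_trans (leq_prefix_level A n) (leq_level _). Qed.

Lemma rec_length_at A n0 : recursive A (fun n => length_at A (n0 + n)).
Proof.
apply: rec_level; rewrite /prefix_level.
have h : recursive A (fun n => str_code (mkseq A (n0 + n))).
  apply: (rec_mkseq (Z := fun _ => A)); last exact: rec_add (rec_const A n0) (rec_id A).
  by rewrite /recursive2; apply: rec_oracle; rec_tac.
by apply: rec_ext (rec_add h h) => n; rewrite addnn.
Qed.

End Levels.

(** To find [A i], B searches for a large element of [M] and decodes its level index. *)
Lemma turing_le_prefix_levels f (rec_f : computable f) (A B : oracle)
    (M : pred nat) m0 :
  recursive B (fun m => M m) -> (forall m, exists2 n, m <= n & M n) ->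
  (forall m, m0 <= m -> M m ->
     exists n, uphalf (level_index f m) = str_code (mkseq A n)) ->
  turing_le A B.
Proof.
move=> recM infM onM.
(* The level index is then at least [2 * 2 ^ i.+1], so the decoded code is at least [2 ^ i.+1] and
   its string is longer than [i]. *)
pose P i m := [&& M m, m0 <= m & level f (2 * 2 ^ i.+1) <= m].
have exP i : exists m, P i m.
  have [m lem Mm] := infM (m0 + level f (2 * 2 ^ i.+1)); exists m.
  by rewrite /P Mm /=; lia.
have rec_g : recursive B (fun i => ex_minn (exP i)).
  apply: rec_mu; rewrite /recursive2; apply: rec_not; apply: rec_and.
    by apply: (rec_app recM); rec_tac.
  apply: rec_and; first by rec_tac.
  by apply: rec_leq; [apply: (rec_level rec_f)|]; rec_tac.
have rec_k := rec_level_index rec_f rec_g.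
suff e i : code_bit ((level_index f (ex_minn (exP i))).+1)./2 i = A i.
  have : recursive B
      (fun i => code_bit ((level_index f (ex_minn (exP i))).+1)./2 i).
    by apply: rec_code_bit; rec_tac.
  by apply: rec_ext => i; rewrite e.
case: ex_minnP => m /and3P[Mm lem lev] _.
have [n en] := onM m lem Mm; rewrite -uphalfE en code_bitE.
have lt_in : i < n; last by rewrite nth_mkseq.
have := leq_ltn_trans lev (level_index_gt f m) => /level_le_inv ltk.
have : 2 ^ i.+1 < 2 ^ n.+1.
  have := str_code_bound (mkseq A n); rewrite size_mkseq -en uphalfE; lia.
by rewrite ltn_exp2l.
Qed.

(** * Dimension 1 relative to [A] *)

Section PaddedReal.
Variables (R : realType) (K : bitseq -> nat).
Hypothesis hK : prefix_free_complexity K.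
Variable f : nat -> nat.
Hypothesis rec_f : computable f.
Variables (A X : oracle) (n0 : nat).
Hypothesis incompressible : forall n, n0 <= n ->
  length_at f A n.+1 - pad_until f A n <= K (mkseq X (length_at f A n.+1)).

Lemma dim_si_padded : dim_si R K A X = 1%E.
Proof.
(* For the lower bound, the coding lengths are taken from index [(n0 + q).+1] on: [n0] for the
   incompressibility, [q] for [pad_until_small], and one more since both speak of [n.+1]. *)
apply/eqP; rewrite Order.POrderTheory.eq_le (dim_si_le1 R hK) /=.
apply: dim_si_ge1 => q.
have mono : {homo (fun n => length_at f A ((n0 + q).+1 + n)) : m n / m < n}.
  apply: homo_ltn => [x y z|n]; first exact: ltn_trans.
  apply: level_lt; rewrite addnS; have := prefix_levelS A ((n0 + q).+1 + n); lia.
have [N [recN inN Nout]] := recursive_range (rec_length_at rec_f A _) mono.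
exists N; split=> // [m|_ /Nout[n ->]].
  exists (length_at f A ((n0 + q).+1 + m)) => //.
  by apply: leq_trans (leq_length_at _ _ _); lia.
rewrite addSn.
have := incompressible (n := n0 + q + n) ltac:(lia).
have := @pad_until_small f A (n0 + q + n) q ltac:(lia).
nia.
Qed.

End PaddedReal.

(** * Dimension 0 of the output relative to [B] *)

Section TotalReduction.
Variables (R : realType) (K : bitseq -> nat).
Hypothesis hK : prefix_free_complexity K.
Variable f : nat -> nat.
Hypothesis rec_f : computable f.
Variable Phi : program.
Hypothesis Phi_bool : forall X n v, computes X Phi n v -> v <= 1.
Hypothesis Phi_use : forall X n v u, run X Phi n v u -> u <= f n.

Lemma computes_use Y Y' i v :
  (forall j, j < f i -> Y j = Y' j) -> computes Y Phi i v -> computes Y' Phi i v.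
Proof.
move=> eqY [u h]; exists u; apply: run_use (h) => j ltj; apply: eqY.
exact: leq_trans ltj (Phi_use h).
Qed.

Hypothesis Phi_total : forall Y, total_with Phi Y.

(** [F] will be applied to zero-padded finite strings, so totality on [X] alone would not
    suffice. *)
Lemma total_output : exists F : oracle -> oracle, forall Y, computes_set Phi Y (F Y).
Proof.
have h (p : oracle * nat) : exists b : bool, computes p.1 Phi p.2 b.
  have [v hv] := Phi_total p.1 p.2; exists (v == 1).
  by have := Phi_bool hv; case: v hv => [|[|]].
by have [F hF] := choice h; exists (fun Y i => F (Y, i)) => Y i; apply: (hF (_, _)).
Qed.

Lemma dim_si_output A B X Z : ~ turing_le A B ->
  (forall n i, length_at f A n <= i < pad_until f A n -> X i = false) ->
  computes_set Phi X Z -> dim_si R K B Z = 0%E.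
Proof.
move=> nAB zeros XZ; apply/eqP; rewrite Order.POrderTheory.eq_le dim_si_ge0 andbT.
rewrite -[0%E]/((0%:R : R)%:E).
apply: dim_si_le => M recM infM q; rewrite muln0 add0n.
apply: contrapT => large.
have [F hF] := total_output.
have recF : recursive2 no_oracle (fun x i => F (code_bit x) i).
  have rec_bit : recursive2 no_oracle (fun x i => code_bit x i).
    by apply: rec_code_bit; rec_tac.
  by apply: (recursive_simulate rec_bit) => s i; apply: hF.
have [m0 hm0] := complexity_le_rate hK q recF.
apply: nAB; apply: (turing_le_prefix_levels rec_f (m0 := maxn m0 1) recM infM) => m.
rewrite geq_max => /andP[lem m_gt0] Mm; set k := level_index f m.
have exn : exists n, prefix_level A n <= k by exists 0.
have bound n : prefix_level A n <= k -> n <= k.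
  by apply: leq_trans; apply: leq_prefix_level.
(* The coding indices around [k] are those of [n] and [n.+1]. If [k] is the former or [k.+1] the
   latter, a prefix of [A] is decoded; otherwise [m] contradicts [large]. *)
case: (ex_maxnP exn bound) => n le_nk maxn.
have lt_kn : k < prefix_level A n.+1.
  by rewrite ltnNge; apply/negP => /maxn; rewrite ltnn.
have [e|ne] := eqVneq (prefix_level A n) k.
  by exists n; rewrite -e /prefix_level uphalf_double.
have [e|ne'] := eqVneq (prefix_level A n.+1) k.+1.
  exists n.+1; move: e; rewrite /prefix_level uphalfE => <-.
  by rewrite doubleK.
case: large; exists m; split=> //; rewrite mul1n.
have km := level_index_le f m; have mk := level_index_gt f m; rewrite -/k in km mk.
set w := mkseq X (length_at f A n).
(* Since [k.+1] is still below the next coding index, [m] lies below the level that defines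
   [pad_until]. *)
have lt_mpad i : i < m -> f i <= pad_until f A n.
  move=> lti; rewrite /pad_until; set l := level _ _.
  have : m < l by apply: leq_trans mk _; apply: level_le; lia.
  by move=> ltl; have := @leq_use_sum f i l ltac:(lia); lia.
(* Within the use of arguments below [m], [X] is [w] followed by zeros. *)
have -> : mkseq Z m = mkseq (F (code_bit (str_code w))) m.
  apply/eq_in_map => i; rewrite mem_iota add0n => /andP[_ lti].
  have : computes (code_bit (str_code w)) Phi i (Z i).
    apply: computes_use (XZ i) => j ltj; rewrite code_bitE.
    case: (ltnP j (length_at f A n)) => h; first by rewrite nth_mkseq.
    rewrite nth_default ?size_mkseq // (zeros n) // h /=.
    exact: leq_trans ltj (lt_mpad i lti).
  by move/(computes_det (hF _ i)); case: (F _ i) (Z i) => [] [].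
apply: hm0 => //; rewrite size_mkseq; apply: ltnW.
(* [k] exceeds the coding index of [n], so the square of the length of [w] is below
   [level k <= m]. *)
apply: leq_trans (level_sqr_lt _ _) (leq_trans _ km).
by apply: level_le; lia.
Qed.

End TotalReduction.

Theorem theorem14 (R : realType) (K : bitseq -> nat)
    (hK : prefix_free_complexity K) (A B : nat -> bool) :
  ~ turing_le A B ->
  forall Phi : program, wtt_reduction Phi ->
  exists X : nat -> bool,
    dim_si R K A X = 1%E /\
    (~ total_with Phi X \/
     exists Z : nat -> bool, computes_set Phi X Z /\ dim_si R K B Z = 0%E).
Proof.
move=> nAB Phi [Phi_bool [f rec_f Phi_use]].
(* Coding starts with the prefix of [A] of length [n0], whose coding length is at least [n0]; the
   positions before it are free to copy [Y]. *)
have build Y n0 : exists X : oracle, (forall i, i < n0 -> X i = Y i) /\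
    forall n, n0 <= n ->
      (forall i, length_at f A n <= i < pad_until f A n -> X i = false) /\
      length_at f A n.+1 - pad_until f A n <= K (mkseq X (length_at f A n.+1)).
  have [||X [XY hX]] := @padded_incompressible K hK
      (fun n => length_at f A (n0 + n)) (fun n => pad_until f A (n0 + n)) Y.
  - by move=> n; rewrite addnS; apply: length_at_pad.
  - by move=> n; apply: leq_trans (leq_length_at _ _ _); apply: leq_addl.
  exists X; split=> [i lti|n /subnKC <-]; last by rewrite -addnS; apply: hX.
  by apply: XY; apply: leq_trans lti _; rewrite addn0; apply: leq_length_at.
have [tot|/existsNP[Y]] := pselect (forall Y, total_with Phi Y).
  have [X [_ hX]] := build no_oracle 0; exists X; split.
    by apply: (dim_si_padded R hK rec_f (n0 := 0)) => n /hX[].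
  have [F hF] := total_output Phi_bool tot.
  right; exists (F X); split; first exact: hF.
  apply: (dim_si_output R hK rec_f Phi_bool Phi_use tot nAB) (hF X).
  by move=> n; apply: (hX n _).1.
(* A computation on [X] at [i] would query only positions below [f i], where [X] agrees with [Y],
   and so would also halt on [Y]. *)
move=> /existsNP[i noY]; have [X [XY hX]] := build Y (f i); exists X; split.
  by apply: (dim_si_padded R hK rec_f (n0 := f i)) => n /hX[].
left=> /(_ i)[v hv]; apply: noY; exists v.
exact: (computes_use Phi_use XY hv).
Qed.
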